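(* Let $k\in\mathbb{Z}^+$ and let $A_0=\{a_s(n_s)\}_{s=0}^k$ be a system of residue classes (with $a_s\in\mathbb{Z}$, $n_s\in\mathbb{Z}^+$) such that $w_{A_0}(a_0)=m(A_0)$. Let $m_1,\ldots,m_k\in\mathbb{Z}$ with $\gcd(m_s,n_s)=1$ for each $s\in[1,k]$. Let $J\subseteq\{1\leqslant s\leqslant k:\, a_0\in a_s(n_s)\}$, let $F$ be a field whose characteristic does not divide $N=\operatorname{lcm}(n_1,\ldots,n_k)$, and let $P(x_1,\ldots,x_k)\in F[x_1,\ldots,x_k]$. Assume that $0\leqslant\deg P\leqslant|J|$ and $$\Big[\prod_{j\in J}x_j\Big]P(x_1,\ldots,x_k)(x_1+\cdots+x_k)^{|J|-\deg P}\neq0 .$$ Let $X_1=\{b_1,c_1\},\ldots,X_k=\{b_k,c_k\}$ be subsets of $F$ (with $b_s,c_s\in F$) such that, for each $s\in[1,k]$, $b_s=c_s$ holds only if $a_0\in a_s(n_s)$ and $s\notin J$. Then there exists a real number $0\leqslant\alpha<1$ such that $$|S_r|\geqslant|J|-\deg P+1>0\quad\text{for all } r=0,1,\ldots,n_0-1,$$ where $$S_r=\Big\{\sum_{s=1}^kx_s:\ x_s\in X_s\ (1\le s\le k),\ P(x_1,\ldots,x_k)\neq0,\ \Big\{\sum_{1\le s\le k,\ x_s\neq b_s}\frac{m_s}{n_s}\Big\}=\frac{\alpha+r}{n_0}\Big\}.$$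
   Context: For $a\in\mathbb{Z}$ and $n\in\mathbb{Z}^+$, $a(n)=a+n\mathbb{Z}$ denotes a residue class. For a finite system $A=\{a_s(n_s)\}_{s\in S}$ of residue classes, its covering function is $w_A(x)=|\{s\in S:\, x\in a_s(n_s)\}|$ for $x\in\mathbb{Z}$, and its covering multiplicity is $m(A)=\min_{x\in\mathbb{Z}}w_A(x)$. $[1,k]=\{1,\ldots,k\}$. $\{x\}$ denotes the fractional part of a real number $x$. $[\prod_{j\in J}x_j]Q$ denotes the coefficient of the monomial $\prod_{j\in J}x_j$ in the polynomial $Q$. The degree of the zero polynomial is not $\ge 0$ (so the hypothesis $\deg P\ge0$ entails $P\neq0$). *)

(* Defs.v *)
From HB Require Import structures.
From mathcomp Require Import all_boot all_order all_algebra.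
From mathcomp Require Import finmap boolp classical_sets cardinality reals.
From mathcomp Require Import mpoly.

Set Implicit Arguments.
Unset Strict Implicit.
Unset Printing Implicit Defensive.
Import Order.TTheory GRing.Theory Num.Theory.

Local Open Scope classical_set_scope.
Local Open Scope ring_scope.

Definition residue_class (a : int) (n : nat) : set int :=
  [set a + n%:Z * q | q in [set: int]].

Section Covering.
Variables (S : finType) (a : S -> int) (n : S -> nat).

Definition covering_function (x : int) : nat :=
  #|[pred s : S | x \in residue_class (a s) (n s)]|.

Lemma covering_function_attained :
  exists w : nat, `[< exists x : int, covering_function x = w >].
Proof. by exists (covering_function 0); apply/asboolP; exists 0. Qed.

Definition covering_multiplicity : nat := ex_minn covering_function_attained.

End Covering.

(* Equal to 0, not to a negative value, at P = 0. *)
Definition total_degree (k : nat) (F : fieldType) (P : {mpoly F[k]}) : nat :=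
  (msize P).-1.

Definition squarefree_monomial (k : nat) (J : {set 'I_k}) : 'X_{1..k} :=
  [multinom (s \in J : nat) | s < k].

Definition frac_part (R : realType) (x : R) : R := x - (Num.floor x)%:~R.

(* The set S_r is obtained at t = (alpha + r) / n_0. *)
Definition restricted_sums (R : realType) (k : nat) (F : fieldType)
    (P : {mpoly F[k]}) (X : 'I_k -> set F) (b : 'I_k -> F)
    (m : 'I_k -> int) (n : 'I_k -> nat) (t : R) : set F :=
  [set \sum_(s < k) x s | x in
    [set x : 'I_k -> F | [/\ forall s, X s (x s), P.@[x] != 0 &
       frac_part (\sum_(s < k | x s != b s) (m s)%:~R / (n s)%:R) = t]]].

(* Main.v *)
(* Write e(t) for exp(2 pi i t), realised in an extension of F by a primitive
   N-th root of unity.  For T a set of indices let x^T take the value c_s on T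
   and b_s off T, where T avoids the indices outside J whose class contains a_0.
   For a polynomial Q put
     h_Q(x) = sum_T Q(x^T) prod_(s in T) - e((a_s - x) m_s / n_s).
   On a monomial the sum factors over s, with factor 0 at s as soon as x lies in
   a_s(n_s) and x_s does not occur.  Counting the classes through x shows that
   h_Q = 0 if deg Q < |J|, and that for deg Q <= |J| the function h_Q is
   supported on a_0(n_0), with h_Q(a_0) a nonzero multiple of [prod_J x_j] Q.
   By Fourier inversion, the partial sums C_Q(t) over the T with
   {sum_(s in T) m_s / n_s} = t are then equivariant under t -> t + 1 / n_0 up to
   nonzero factors, so Q_0 = P (x_1 + ... + x_k)^(|J| - deg P) has
   C_(Q_0)((alpha + r) / n_0) <> 0 for some alpha and all r.  If some S_r were
   too small, replacing |S_r| of the factors x_1 + ... + x_k by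
   x_1 + ... + x_k - z, z in S_r, would change Q_0 only in degree < |J|, hence
   not change C, while making the sum C((alpha + r) / n_0) vanish term by term. *)
Require Import Defs.
From HB Require Import structures.
From mathcomp Require Import all_boot all_order all_algebra.
From mathcomp Require Import fieldext separable cyclic cyclotomic.
From mathcomp Require Import finmap boolp classical_sets cardinality reals.
From mathcomp Require Import mpoly.
From mathcomp Require Import ring zify.

Set Implicit Arguments.
Unset Strict Implicit.
Unset Printing Implicit Defensive.
Import Order.TTheory GRing.Theory Num.Theory.

Local Open Scope classical_set_scope.
Local Open Scope ring_scope.

(** * Primitive roots of unity in field extensions *)

Lemma irreducible_factor (F : fieldType) (p : {poly F}) : (1 < size p)%N ->
  exists2 q : {poly F}, irreducible_poly q & q %| p.
Proof.
have [l] := ubnP (size p); elim: l p => // l IHl p le_pl p_gt1.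
have [irr_p|] := pselect (irreducible_poly p); first by exists p.
move=> red_p; have [q [q_neq1 q_dvd ne_qp]] :
    exists q : {poly F}, [/\ size q != 1%N, q %| p & ~~ (q %= p)].
  apply: contrapT => noq; apply: red_p; split=> // q q1 qp.
  by apply: contrapT => /negP nqp; apply: noq; exists q.
have p_neq0 : p != 0 by rewrite -size_poly_gt0 ltnW.
have lt_qp : (size q < size p)%N.
  by rewrite ltn_neqAle dvdp_size_eqp // ne_qp dvdp_leq.
have q_gt1 : (1 < size q)%N.
  by rewrite ltn_neqAle eq_sym q_neq1 size_poly_gt0 (dvdpN0 q_dvd).
have [r irr_r r_dvd] := IHl q (leq_trans lt_qp le_pl) q_gt1.
by exists r => //; apply: dvdp_trans q_dvd.
Qed.

Lemma root_in_extension (F : fieldType) (p : {poly F}) : (1 < size p)%N ->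
  exists (L : fieldType) (f : {rmorphism F -> L}) (z : L), root (map_poly f p) z.
Proof.
move=> /irreducible_factor[q irr_q /dvdpP[r ->]].
have [L _ [z qz0 _]] := irredp_FAdjoin irr_q.
exists L, (in_alg L), z.
by rewrite rmorphM rootM qz0 orbT.
Qed.

(** Roots are adjoined one at a time; each step enlarges the base field, so the induction on the
    size quantifies over [F]. *)
Lemma splitting_extension (F : fieldType) (p : {poly F}) : p != 0 ->
  exists (L : fieldType) (f : {rmorphism F -> L}) (rs : seq L),
    map_poly f p %= \prod_(z <- rs) ('X - z%:P).
Proof.
have [l] := ubnP (size p); elim: l F p => // l IHl F p le_pl p_neq0.
have [p_le1|/root_in_extension[K [f [z /factor_theorem[q pq]]]]] := leqP (size p) 1.
  exists F, idfun, [::]; rewrite big_nil map_poly_id // -size_poly_eq1.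
  by rewrite eqn_leq p_le1 size_poly_gt0.
have q_neq0 : q != 0.
  apply: contraNneq p_neq0 => q0; rewrite -(map_poly_eq0 f) pq q0 mul0r //.
have size_q : (size q < l)%N.
  move: le_pl; rewrite -(size_map_poly f) pq size_Mmonic ?monicXsubC //.
  by rewrite size_XsubC addn2.
have [L [g [rs qrs]]] := IHl K q size_q q_neq0.
exists L, (g \o f : {rmorphism F -> L}), (g z :: rs).
rewrite map_poly_comp pq rmorphM /= big_cons mulrC map_polyXsubC.
by rewrite eqp_mull.
Qed.

(** As N is nonzero in F, X^N - 1 is separable; its N distinct roots in a splitting field include
    one of order N. *)
Lemma primitive_root_in_extension (F : fieldType) (N : nat) : N%:R != 0 :> F ->
  exists (L : fieldType) (f : {rmorphism F -> L}) (z : L), N.-primitive_root z.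
Proof.
move=> N_neq0; have N_gt0 : (0 < N)%N.
  by case: N N_neq0 => //; rewrite mulr0n eqxx.
have [|L [f [rs]]] := @splitting_extension F ('X^N - 1).
  by rewrite -size_poly_eq0 size_XnsubC.
rewrite rmorphB rmorph1 /= map_polyXn => eq_rs; exists L, f.
have uniq_rs : uniq rs.
  rewrite -separable_prod_XsubC -(eqp_separable eq_rs).
  by apply: separable_Xn_sub_1; rewrite -(rmorph_nat f) fmorph_eq0.
have unity_rs : all N.-unity_root rs.
  apply/allP=> z z_rs; rewrite unity_rootE -subr_eq0.
  have := root_prod_XsubC rs z; rewrite -(eqp_root eq_rs) z_rs.
  by rewrite rootE !hornerE.
have size_rs : (N <= size rs)%N.
  have := eqp_size eq_rs; rewrite size_XnsubC // size_prod_XsubC.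
  by move=> /eqP; rewrite eqSS => /eqP ->.
by have /hasP[z _ prim_z] := has_prim_root N_gt0 unity_rs uniq_rs size_rs; exists z.
Qed.

(** * Fourier inversion modulo N *)

Lemma divn_dvd_gt0 (d N : nat) : (0 < N)%N -> (d %| N)%N -> (0 < N %/ d)%N.
Proof.
by move=> N_gt0 dN; rewrite divn_gt0 ?(dvdn_gt0 N_gt0 dN) // (dvdn_leq N_gt0 dN).
Qed.

Section Fourier.

Variables (L : fieldType) (N : nat) (z : L).
Hypothesis prim_z : N.-primitive_root z.
Hypothesis N_neq0 : N%:R != 0 :> L.
Let N_gt0 : (0 < N)%N := prim_order_gt0 prim_z.

Lemma prim_root_neq0 : z != 0.
Proof.
apply/eqP => z0; have := prim_expr_order prim_z.
by move/eqP; rewrite z0 expr0n gtn_eqF // eq_sym oner_eq0.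
Qed.
Let z_neq0 := prim_root_neq0.

Lemma prim_root_expz_eq1 (i : int) : (z ^ i == 1) = (N%:Z %| i)%Z.
Proof.
rewrite dvdzE /= (prim_order_dvd prim_z).
by case: i => i //=; rewrite NegzE -exprz_inv -exprnP exprVn invr_eq1.
Qed.

Lemma prim_root_expz_dvd (i : int) : (N%:Z %| i)%Z -> z ^ i = 1.
Proof. by rewrite -prim_root_expz_eq1 => /eqP. Qed.

Lemma sum_prim_root_expz (i : int) :
  \sum_(x < N) z ^ (x%:Z * i) = if (N%:Z %| i)%Z then N%:R else 0.
Proof.
under eq_bigr do rewrite mulrC -exprz_exp -exprnP.
rewrite -prim_root_expz_eq1; have [->|ne1] := eqVneq.
  by under eq_bigr do rewrite expr1n; rewrite sumr_const card_ord.
apply/eqP; have := subrX1 (z ^ i) N.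
rewrite exprnP exprz_exp mulrC -exprz_exp -exprnP (prim_expr_order prim_z).
rewrite exp1rz subrr => /esym/eqP; rewrite mulf_eq0 subr_eq0.
by rewrite (negPf ne1).
Qed.

Variables (I : finType) (V : pred I) (g : I -> L) (e : I -> int).

Definition fourier (x : int) : L := \sum_(i | V i) g i * z ^ (- (x * e i)).
(** The coefficient of the character x -> z^(-x j) in [fourier]: amplitudes are grouped by frequency
    modulo N. *)
Definition fourier_coef (j : int) : L :=
  \sum_(i | V i && (N%:Z %| e i - j)%Z) g i.

Lemma fourier_inversion (j : int) :
  N%:R * fourier_coef j = \sum_(x < N) fourier x * z ^ (x%:Z * j).
Proof.
under eq_bigr do rewrite mulr_suml.
rewrite exchange_big /= /fourier_coef mulr_sumr big_mkcondr /=.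
apply: eq_bigr => i _.
under eq_bigr => x _.
  rewrite -mulrA -expfzDr // (_ : _ + _ = x%:Z * - (e i - j)); last by ring.
  over.
rewrite -mulr_sumr sum_prim_root_expz rpredN.
by case: ifP; rewrite ?mulr0 // mulrC.
Qed.

Lemma fourier_coef_eq0 (j : int) :
  (forall x, fourier x = 0) -> fourier_coef j = 0.
Proof.
move=> H0; apply/eqP; have := fourier_inversion j.
under eq_bigr do rewrite H0 mul0r.
by rewrite big1_eq => /eqP; rewrite mulf_eq0 (negPf N_neq0).
Qed.

Lemma fourierE (x : int) :
  fourier x = \sum_(j < N) fourier_coef j%:Z * z ^ (- (x * j%:Z)).
Proof.
under [RHS]eq_bigr do rewrite mulr_suml big_mkcondr /=.
rewrite exchange_big /=; apply: eq_bigr => i _.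
have N0 : N%:Z != 0 by rewrite eqz_nat -lt0n.
have lt_eN : (`|(e i %% N)%Z| < N)%N.
  by have := ltz_mod (e i) N0; have := modz_ge0 (e i) N0; lia.
pose j0 := Ordinal lt_eN.
have j0E : j0%:Z = (e i %% N)%Z by rewrite /= gez0_abs // modz_ge0.
have dvdj (j : 'I_N) : (N%:Z %| e i - j%:Z)%Z = (j == j0).
  rewrite -eqz_mod_dvd (@modz_small j); last by have := ltn_ord j; lia.
  by rewrite -j0E eqz_nat eq_sym.
rewrite (bigD1 j0) // big1 ?addr0; last first.
  by move=> j nej; rewrite dvdj (negPf nej).
rewrite dvdj eqxx j0E /= addr0; congr (_ * _).
have dvdd : z ^ (x * e i - x * (e i %% N)%Z) = 1.
  apply: prim_root_expz_dvd.
  by rewrite -mulrBr dvdz_mull // {1}(divz_eq (e i) N) addrK dvdz_mull.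
by rewrite -[LHS]mul1r -dvdd -expfzDr //; congr (_ ^ _); ring.
Qed.

Variables (n0 : nat) (a0 : int).
Hypothesis fourier_supp :
  forall x, ~~ (n0%:Z %| x - a0)%Z -> fourier x = 0.
Hypothesis fourier_a0 : fourier a0 != 0.

(** By N-periodicity [fourier] is also nonzero at a0 + N, which must then lie in a0(n0). *)
Lemma fourier_period_dvd : (n0 %| N)%N.
Proof.
have fourierDN : fourier (a0 + N%:Z) = fourier a0.
  apply: eq_bigr => i _; congr (_ * _); rewrite mulrDl opprD expfzDr //.
  by rewrite (@prim_root_expz_dvd (- (N%:Z * _))) ?mulr1 // rpredN dvdz_mulr.
apply: contraNT fourier_a0; rewrite -fourierDN => ndvd.
by rewrite fourier_supp // addrAC subrr add0r.
Qed.

(** Only x congruent to a0 modulo n0 contribute to the inversion formula, and for these z^(x N/n0) =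
    z^(a0 N/n0). *)
Lemma fourier_coef_shift (j : int) :
  fourier_coef (j + (N %/ n0)%N%:Z) = z ^ (a0 * (N %/ n0)%N%:Z) * fourier_coef j.
Proof.
apply: (mulfI N_neq0); rewrite mulrCA !fourier_inversion mulr_sumr.
apply: eq_bigr => x _.
have [xa|/fourier_supp ->] := boolP (n0%:Z %| x%:Z - a0)%Z; last first.
  by rewrite !mul0r mulr0.
rewrite mulrCA; congr (_ * _).
have -> : x%:Z * (j + (N %/ n0)%N%:Z) =
    (x%:Z - a0) * (N %/ n0)%N%:Z + (a0 * (N %/ n0)%N%:Z + x%:Z * j) by ring.
rewrite !expfzDr // [X in X * _]prim_root_expz_dvd ?mul1r //.
by rewrite -[X in (X%:Z %| _)%Z](divnK fourier_period_dvd) PoszM mulrC dvdz_mul.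
Qed.

(** Since [fourier] is nonzero at a0, some coefficient j is nonzero; shifts by N/n0 preserve this,
    and t is the residue of j modulo N/n0. *)
Lemma exists_fourier_coef_coset : exists t : nat,
  (t < N %/ n0)%N /\
  forall r : nat, fourier_coef (t + r * (N %/ n0))%N%:Z != 0.
Proof.
have [j Cj] : exists j, fourier_coef j != 0.
  apply: contrapT => noj; move/eqP: fourier_a0; apply.
  rewrite fourierE big1 // => j _.
  apply/eqP; rewrite mulf_eq0; apply/orP; left; apply: contrapT => /negP Cj.
  by apply: noj; exists j%:Z.
set d := (N %/ n0)%N.
have d_gt0 : (0 < d)%N by rewrite divn_dvd_gt0 // fourier_period_dvd.
have unit_z i : z ^ i != 0 by rewrite expfz_neq0.
have shift (r : nat) (i : int) :
    (fourier_coef (i + (r * d)%N%:Z) != 0) = (fourier_coef i != 0).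
  elim: r => [|r IHr]; first by rewrite mul0n addr0.
  rewrite mulSn addnC PoszD addrA fourier_coef_shift mulf_eq0 negb_or unit_z.
  by rewrite IHr.
have d_neq0 : d%:Z != 0 by rewrite eqz_nat -lt0n.
have shiftz (q i : int) :
    (fourier_coef (i + q * d%:Z) != 0) = (fourier_coef i != 0).
  case: q => q; first by rewrite -PoszM shift.
  by rewrite -(shift q.+1) NegzE PoszM mulNr subrK.
exists `|(j %% d)%Z|%N; split.
  by have := ltz_mod j d_neq0; have := modz_ge0 j d_neq0; lia.
move=> r; rewrite PoszD gez0_abs ?modz_ge0 // shift.
by rewrite -(shiftz (j %/ d)%Z) addrC -divz_eq.
Qed.
End Fourier.

(** * Alternating sums over the points x^T *)

Lemma mdeg_squarefree_monomial (k : nat) (W : {set 'I_k}) :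
  mdeg (squarefree_monomial W) = #|W|.
Proof.
rewrite mdegE -sum1_card [RHS]big_mkcond; apply: eq_bigr => s _.
by rewrite mnmE; case: ifP.
Qed.

(** If mu is positive on all of W, it dominates the indicator of W, and the degree bound forces
    equality. *)
Lemma multinom_vanishing_index (k : nat) (W : {set 'I_k}) (mu : 'X_{1..k}) :
  (mdeg mu <= #|W|)%N -> mu != squarefree_monomial W ->
  exists2 s, s \in W & mu s = 0%N.
Proof.
move=> le_mu ne_mu; apply: contrapT => nos; case/negP: ne_mu.
set chi := squarefree_monomial W.
have leif_mu (s : 'I_k) : true -> (chi s <= mu s ?= iff (chi s == mu s))%N.
  move=> _; split=> //; rewrite mnmE.
  have [sW /=|//] := boolP (s \in W).
  by rewrite lt0n; apply/eqP => mu0; apply: nos; exists s.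
have [] := leqif_sum leif_mu; rewrite -!mdegE mdeg_squarefree_monomial.
move=> le_sum; rewrite eqn_leq le_sum le_mu => /esym/forallP eq_mu.
by apply/eqP/mnmP => s; apply/esym/eqP/(implyP (eq_mu s)).
Qed.

Definition switch (F : Type) (k : nat) (b c : 'I_k -> F) (T : {set 'I_k})
  (s : 'I_k) : F := if s \in T then c s else b s.

Section AlternatingSum.

Variables (F L : fieldType) (f : {rmorphism F -> L}) (k : nat).
Variables (b c : 'I_k -> F) (V : {set 'I_k}).

(** This is h_Q(x) when y_s = e((a_s - x) m_s / n_s). *)
Definition switch_sum (y : 'I_k -> L) (Q : {mpoly F[k]}) : L :=
  \sum_(T : {set 'I_k} | T \subset V) f Q.@[switch b c T] * \prod_(s in T) - y s.

Definition switch_factor (y : 'I_k -> L) (mu : 'X_{1..k}) (s : 'I_k) : L :=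
  f (b s ^+ mu s) - (if s \in V then y s * f (c s ^+ mu s) else 0).

(** For a monomial, the sum over T expands a product in which each s chooses between b_s (s not in
    T) and c_s with factor -y_s (s in T). *)
Lemma switch_sumE y Q : switch_sum y Q =
  \sum_(mu <- msupp Q) f Q@_mu * \prod_s switch_factor y mu s.
Proof.
rewrite /switch_sum.
under eq_bigr do rewrite mevalE rmorph_sum mulr_suml.
rewrite exchange_big /=; apply: eq_bigr => mu _.
under eq_bigr do rewrite rmorphM -mulrA.
rewrite -mulr_sumr; congr (_ * _).
under [RHS]eq_bigr do rewrite /switch_factor addrC.
rewrite bigA_distr big_mkcond /=; apply: eq_big => // T _.
(* A set T not contained in V picks the entry 0 at some s outside V. *)
have [TV|/subsetPn[s sT sV]] := boolP (T \subset V); last first.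
  by rewrite (bigD1 s) //= sT (negPf sV) oppr0 mul0r.
rewrite rmorph_prod [X in _ * X]big_mkcond -big_split /=; apply: eq_bigr => s _.
rewrite /switch; case: ifP => sT; last by rewrite mulr1.
by rewrite (fintype.subsetP TV) // mulrC mulNr.
Qed.

Lemma switch_factor_eq0 y (mu : 'X_{1..k}) s :
  s \in V -> y s = 1 -> mu s = 0%N -> switch_factor y mu s = 0.
Proof.
by move=> sV y1 mu0; rewrite /switch_factor sV y1 mu0 !expr0 mul1r subrr.
Qed.

Variables (y : 'I_k -> L) (W : {set 'I_k}).
Hypotheses (WV : W \subset V) (y_W : forall s, s \in W -> y s = 1).

Lemma switch_prod_eq0 mu : (mdeg mu <= #|W|)%N -> mu != squarefree_monomial W ->
  \prod_s switch_factor y mu s = 0.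
Proof.
move=> le_mu ne_mu; have [s sW mu0] := multinom_vanishing_index le_mu ne_mu.
by rewrite (bigD1 s) //= switch_factor_eq0 ?mul0r ?y_W // (fintype.subsetP WV).
Qed.

Lemma switch_sum_eq0 (Q : {mpoly F[k]}) : (msize Q <= #|W|)%N -> switch_sum y Q = 0.
Proof.
move=> le_Q; rewrite switch_sumE big_seq big1 // => mu mu_Q.
have lt_mu : (mdeg mu < #|W|)%N := leq_trans (msize_mdeg_lt mu_Q) le_Q.
rewrite switch_prod_eq0 ?mulr0 ?(ltnW lt_mu) //.
by apply: contraTneq lt_mu => ->; rewrite mdeg_squarefree_monomial ltnn.
Qed.

(** Only the squarefree monomial of W survives; its factors are f(b_s) - f(c_s) on W, 1 - y_s on the
    rest of V, and 1 outside V. *)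
Lemma switch_sum_neq0 (Q : {mpoly F[k]}) :
  (forall s, s \in W -> b s <> c s) ->
  (forall s, s \in V -> s \notin W -> y s != 1) ->
  (msize Q <= #|W|.+1)%N -> Q@_(squarefree_monomial W) != 0 ->
  switch_sum y Q != 0.
Proof.
move=> bc y_neq1 le_Q Q_W.
rewrite switch_sumE (bigD1_seq (squarefree_monomial W)) ?msupp_uniq ?mcoeff_msupp //=.
rewrite [X in _ + X]big_seq_cond.
rewrite [X in _ + X]big1 ?addr0 => [|mu /andP[mu_Q ne_mu]]; last first.
  by rewrite switch_prod_eq0 ?mulr0 // -ltnS (leq_trans (msize_mdeg_lt mu_Q)).
rewrite mulf_neq0 ?fmorph_eq0 //; apply/prodf_neq0 => s _.
rewrite /switch_factor mnmE; have [sW|sW] := boolP (s \in W).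
  rewrite (fintype.subsetP WV) // y_W // mul1r !expr1 subr_eq0.
  by apply/eqP => /fmorph_inj; apply: bc.
rewrite !expr0 rmorph1 mulr1; case: ifP => sV; last by rewrite subr0 oner_eq0.
by rewrite subr_eq0 eq_sym y_neq1.
Qed.

End AlternatingSum.

(** * Degree bounds for products and for powers of the sum of the variables *)

Section Degree.

Variables (F : fieldType) (k : nat).
Implicit Types p q : {mpoly F[k]}.

(** [msize] is the degree plus one, and 0 at the zero polynomial, so the shift by one sits on a
    single factor. *)
Lemma msizeM_leq p q i j :
  (msize p <= i.+1)%N -> (msize q <= j)%N -> (msize (p * q) <= i + j)%N.
Proof.
move=> le_p le_q; have [->|p0] := eqVneq p 0; first by rewrite mul0r msize0.
have [->|q0] := eqVneq q 0; first by rewrite mulr0 msize0.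
by rewrite msizeM // -subn1 leq_subLR add1n -addSn leq_add.
Qed.

Lemma msizeB_leq p q i :
  (msize p <= i)%N -> (msize q <= i)%N -> (msize (p - q) <= i)%N.
Proof.
move=> le_p le_q; apply: leq_trans (msizeD_le _ _) _.
by rewrite msizeN geq_max le_p.
Qed.

Local Notation sigma := (\sum_(s < k) 'X_s : {mpoly F[k]}).

Lemma msize_sumX : (msize sigma <= 2)%N.
Proof.
apply: (big_ind (fun p => msize p <= 2)%N) => [|p q p2 q2|s _]; first by rewrite msize0.
  by rewrite (leq_trans (msizeD_le _ _)) // geq_max p2.
by rewrite msizeX mdeg1.
Qed.

Lemma msize_sumX_exp d : (msize (sigma ^+ d) <= d.+1)%N.
Proof.
elim: d => [|d IHd]; first by rewrite expr0 msize1.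
by rewrite exprS; apply: (@msizeM_leq _ _ 1 d.+1 msize_sumX IHd).
Qed.

Lemma msize_prod_sumX_sub (zs : seq F) :
  (msize (\prod_(z <- zs) (sigma - z%:MP) - sigma ^+ size zs) <= size zs)%N.
Proof.
elim: zs => [|z zs IHzs]; first by rewrite big_nil expr0 subrr msize0.
rewrite big_cons /= exprS.
set A := \prod_(_ <- _) _ in IHzs *; set B := sigma ^+ _ in IHzs *.
(* The first term is small by induction, the second because it trades one factor [sigma] for a
   constant. *)
have -> : (sigma - z%:MP) * A - sigma * B = (sigma - z%:MP) * (A - B) - z%:MP * B.
  by ring.
apply: msizeB_leq.
  apply: (@msizeM_leq _ _ 1 (size zs) _ IHzs); apply: msizeB_leq msize_sumX _.
  by rewrite msizeC; case: eqP.
apply: (@msizeM_leq _ _ 0 (size zs).+1 _ (msize_sumX_exp _)).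
by rewrite msizeC; case: eqP.
Qed.

End Degree.

(** * Fractional parts, residue classes and covering functions *)

Lemma frac_part_divz (R : realType) (N j : nat) (i : int) : (j < N)%N ->
  (N%:Z %| i - j%:Z)%Z -> frac_part (i%:~R / N%:R : R) = j%:R / N%:R.
Proof.
move=> lt_jN /dvdzP[q /eqP]; rewrite subr_eq => /eqP ->.
have N_gt0 : 0 < N%:R :> R by rewrite ltr0n (leq_ltn_trans _ lt_jN).
rewrite rmorphD rmorphM /= -!pmulrn mulrDl mulfK ?gt_eqF // /frac_part.
rewrite (@floor_def _ _ q); first by rewrite addrAC subrr add0r.
rewrite -[X in X <= _]addr0 lerD2l divr_ge0 ?ler0n //=.
by rewrite intrD ltrD2l ltr_pdivrMr // mul1r ltr_nat.
Qed.

Lemma residue_classP (a : int) (n : nat) (x : int) :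
  (x \in residue_class a n) = (n%:Z %| x - a)%Z.
Proof.
apply/idP/dvdzP => [|[q xq]]; rewrite inE.
  by case=> q _ <-; exists q; ring.
by exists q => //; rewrite mulrC -xq; ring.
Qed.

Lemma natr_neq0_of_pchar (F : fieldType) (N : nat) : (0 < N)%N ->
  (forall p : nat, p \in [pchar F] -> ~~ (p %| N)%N) -> N%:R != 0 :> F.
Proof.
move=> N_gt0 ndvd; rewrite natf_neq0_pchar /pnat N_gt0; apply/allP => p.
by rewrite mem_primes => /and3P[_ _ dvd_p]; apply: contraL dvd_p; apply: ndvd.
Qed.

Lemma biglcmn_gt0 (I : finType) (n : I -> nat) :
  (forall s, 0 < n s)%N -> (0 < \big[lcmn/1]_s n s)%N.
Proof.
by move=> n_gt0; apply: (big_ind (fun m => 0 < m)%N) => // m1 m2 H1 H2;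
   rewrite lcmn_gt0 H1.
Qed.

Lemma covering_functionE (k : nat) (a : 'I_k.+1 -> int) (n : 'I_k.+1 -> nat)
    (x : int) :
  covering_function a n x = ((n ord0 %| (x - a ord0)%R)%Z +
    #|[set s : 'I_k | (n (lift ord0 s) %| (x - a (lift ord0 s))%R)%Z]%SET|)%N.
Proof.
rewrite /covering_function -[LHS]sum1_card [LHS]big_mkcond big_ord_recl /=.
congr (_ + _)%N; first by rewrite inE residue_classP; case: ifP.
rewrite -sum1_card [RHS]big_mkcond; apply: eq_bigr => s _.
by rewrite !inE residue_classP.
Qed.

Lemma covering_multiplicity_min (S : finType) (a : S -> int) (n : S -> nat)
    (x : int) :
  (covering_multiplicity a n <= covering_function a n x)%N.
Proof.
rewrite /covering_multiplicity; case: ex_minnP => w _; apply.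
by apply/asboolP; exists x.
Qed.

(** * Phases and frequency coefficients of the system *)

Section System.

Variables (F L : fieldType) (f : {rmorphism F -> L}) (N : nat) (z : L).
Hypothesis prim_z : N.-primitive_root z.
Hypothesis N_neq0 : N%:R != 0 :> L.
Variables (k : nat) (a : 'I_k -> int) (n : 'I_k -> nat) (m : 'I_k -> int).
Hypothesis n_dvd : forall s, (n s %| N)%N.
Hypothesis m_coprime : forall s, coprimez (m s) (n s).

Let N_gt0 : (0 < N)%N := prim_order_gt0 prim_z.
Let z_neq0 : z != 0 := prim_root_neq0 prim_z.
Let N_div s : N%:Z = (n s)%:Z * (N %/ n s)%N%:Z.
Proof. by rewrite -PoszM mulnC divnK. Qed.

(* The root of unity e((a_s - x) m_s / n_s). *)
Definition phase (x : int) (s : 'I_k) : L :=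
  z ^ ((a s - x) * (m s * (N %/ n s)%N%:Z)).

(** After cancelling N / n_s, coprimality of m_s and n_s removes m_s from the divisibility. *)
Lemma phase_eq1 x s : (phase x s == 1) = (n s %| x - a s)%Z.
Proof.
rewrite /phase (prim_root_expz_eq1 prim_z) {1}(N_div s) mulrA dvdz_mul2r.
  by rewrite Gauss_dvdzl 1?coprimez_sym // -[in LHS]opprB rpredN.
have : (0 < N %/ n s)%N by apply: divn_dvd_gt0.
by case: (N %/ n s)%N.
Qed.

(* N times the sum of the m_s / n_s over T. *)
Definition exponent (T : {set 'I_k}) : int :=
  \sum_(s in T) m s * (N %/ n s)%N%:Z.

Variables (b c : 'I_k -> F) (V : {set 'I_k}).

(** The amplitude of T: phases are taken at x = 0, the dependence on x being carried by
    [exponent T]. *)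
Definition weight (Q : {mpoly F[k]}) (T : {set 'I_k}) : L :=
  f Q.@[switch b c T] * \prod_(s in T) - phase 0 s.

Lemma switch_sum_fourier Q x :
  switch_sum f b c V (phase x) Q =
  fourier z (fun T : {set _} => T \subset V) (weight Q) exponent x.
Proof.
apply: eq_bigr => T _; rewrite /weight -mulrA; congr (_ * _).
have -> : - (x * exponent T) = \sum_(s in T) - (x * (m s * (N %/ n s)%N%:Z)).
  by rewrite /exponent mulr_sumr sumrN.
rewrite (big_morph (fun i : int => z ^ i) (id1 := 1) (op1 := *%R)) //; last first.
  by move=> i j; rewrite expfzDr.
rewrite -big_split /=; apply: eq_bigr => s _.
rewrite mulNr /phase -expfzDr //; congr (- (_ ^ _)); ring.
Qed.

(* C_Q(j / N), the sum over the T with {sum_(s in T) m_s / n_s} = {j / N}. *)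
Definition freq_coef (Q : {mpoly F[k]}) (j : int) : L :=
  fourier_coef N (fun T : {set _} => T \subset V) (weight Q) exponent j.

Lemma freq_coefB Q Q' j : freq_coef (Q - Q') j = freq_coef Q j - freq_coef Q' j.
Proof.
rewrite /freq_coef /fourier_coef -sumrB; apply: eq_bigr => T _.
by rewrite /weight mevalB rmorphB mulrBl.
Qed.

Lemma freq_coef_eq0 (Q : {mpoly F[k]}) j :
  (forall T : {set 'I_k}, T \subset V -> (N%:Z %| exponent T - j)%Z ->
     Q.@[switch b c T] = 0) ->
  freq_coef Q j = 0.
Proof.
move=> Q0; rewrite /freq_coef /fourier_coef big1 // => T /andP[TV Tj].
by rewrite /weight Q0 // rmorph0 mul0r.
Qed.

Definition covered (x : int) : {set 'I_k} := [set s in V | (n s %| (x - a s)%R)%Z]%SET.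

Lemma covered_sub x : covered x \subset V.
Proof. by apply/fintype.subsetP => s; rewrite inE => /andP[]. Qed.

Lemma phase_covered x s : s \in covered x -> phase x s = 1.
Proof. by rewrite inE -phase_eq1 => /andP[_ /eqP]. Qed.

(** Each x admits W = [covered x] in [switch_sum_eq0], so h_Q vanishes identically and with it every
    coefficient. *)
Lemma freq_coef_small_degree (Q : {mpoly F[k]}) j :
  (forall x, (msize Q <= #|covered x|)%N) -> freq_coef Q j = 0.
Proof.
move=> le_Q; apply: (fourier_coef_eq0 prim_z N_neq0) => x.
rewrite -switch_sum_fourier.
exact: (switch_sum_eq0 _ _ _ (covered_sub x) (@phase_covered x)).
Qed.

(** Off a0(n0) the larger [covered x] exceeds the degree, so h_Q vanishes there; at a0 the
    coefficient hypothesis gives h_Q(a0) nonzero. *)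
Lemma exists_freq_coef_coset (n0 : nat) (a0 : int) (Q : {mpoly F[k]}) :
  (forall x, ~~ (n0 %| x - a0)%Z -> (#|covered a0| < #|covered x|)%N) ->
  (forall s, s \in covered a0 -> b s <> c s) ->
  (msize Q <= #|covered a0|.+1)%N ->
  Q@_(squarefree_monomial (covered a0)) != 0 ->
  (n0 %| N)%N /\ exists t : nat, (t < N %/ n0)%N /\
    forall r : nat, freq_coef Q (t + r * (N %/ n0))%N%:Z != 0.
Proof.
move=> cov_off bc le_Q Q_cov.
set H := fourier z (fun T : {set _} => T \subset V) (weight Q) exponent.
have H_off x : ~~ (n0 %| x - a0)%Z -> H x = 0.
  move=> /cov_off lt_cov; rewrite /H -switch_sum_fourier.
  apply: (switch_sum_eq0 _ _ _ (covered_sub x) (@phase_covered x)).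
  exact: leq_trans le_Q lt_cov.
have H_a0 : H a0 != 0.
  rewrite /H -switch_sum_fourier.
  apply: (switch_sum_neq0 f (covered_sub a0) (@phase_covered a0) bc) => // s sV.
  by rewrite inE sV phase_eq1.
split; first exact: (fourier_period_dvd prim_z H_off H_a0).
exact: (exists_fourier_coef_coset prim_z N_neq0 H_off H_a0).
Qed.

End System.

(** * Multiples of P by shifted sums of the variables *)

Section SumPolynomial.

Variables (F : fieldType) (k : nat) (P : {mpoly F[k]}).
Local Notation sigma := (\sum_(s < k) 'X_s : {mpoly F[k]}).

Lemma msize_mul_sumX_exp d : (msize (P * sigma ^+ d) <= (total_degree P + d).+1)%N.
Proof.
rewrite -addnS.
exact: (@msizeM_leq _ _ P _ (total_degree P) d.+1 (leqSpred _) (msize_sumX_exp _ _ d)).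
Qed.

Lemma msize_mul_prod_sumX_sub (zs : seq F) d : (size zs <= d)%N ->
  (msize (P * (\prod_(z <- zs) (sigma - z%:MP) * sigma ^+ (d - size zs)) -
          P * sigma ^+ d) <= total_degree P + d)%N.
Proof.
move=> le_zs; rewrite -mulrBr.
apply: (@msizeM_leq _ _ P _ (total_degree P) d (leqSpred _)).
have -> : sigma ^+ d = sigma ^+ size zs * sigma ^+ (d - size zs).
  by rewrite -exprD subnKC.
rewrite -mulrBl mulrC -[X in (_ <= X)%N](subnK le_zs).
exact: (@msizeM_leq _ _ _ _ _ _ (msize_sumX_exp _ _ _) (msize_prod_sumX_sub _ _)).
Qed.

Lemma meval_sumX (v : 'I_k -> F) : sigma.@[v] = \sum_(s < k) v s.
Proof. by rewrite rmorph_sum /=; apply: eq_bigr => s _; rewrite mevalXU. Qed.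

Lemma meval_prod_sumX_eq0 (zs : seq F) (v : 'I_k -> F) :
  \sum_(s < k) v s \in zs -> (\prod_(z <- zs) (sigma - z%:MP)).@[v] = 0.
Proof.
move=> v_zs; rewrite rmorph_prod (big_rem _ v_zs) /=.
by rewrite mevalB mevalC meval_sumX subrr mul0r.
Qed.

End SumPolynomial.

(** * The sets of restricted sums and the final contradiction *)

Lemma switch_neq (F : eqType) (k : nat) (b c : 'I_k -> F) (T : {set 'I_k}) s :
  (s \in T -> b s <> c s) -> (switch b c T s != b s) = (s \in T).
Proof.
by rewrite /switch; case: ifP => [_ /(_ isT)/nesym/eqP|_ _]; rewrite ?eqxx.
Qed.

(** Every admissible x is some x^T. Finiteness matters since [fset_set] is empty on infinite
    sets. *)
Lemma restricted_sums_finite (R : realType) (k : nat) (F : fieldType)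
    (P : {mpoly F[k]}) (b c : 'I_k -> F) (m : 'I_k -> int) (n : 'I_k -> nat)
    (t : R) :
  finite_set (restricted_sums P (fun s => [set b s; c s]) b m n t).
Proof.
apply: (@sub_finite_set _ _
  ((fun T : {set 'I_k} => \sum_s switch b c T s) @` [set: {set 'I_k}])).
  move=> _ [x [x_bc _ _] <-]; exists (finset (fun s => x s == c s)) => //.
  apply: eq_bigr => s _; rewrite /switch inE; case: eqP => [->//|ne_c].
  by case: (x_bc s).
exact/finite_image/finite_finset.
Qed.

(* Index 0 of the system is [ord0 : 'I_k.+1]; the index s in [1, k] is
   [lift ord0 s'] with s' : 'I_k. *)
Theorem theorem2p1 (R : realType) (k : nat) (k_gt0 : (0 < k)%N)
    (a : 'I_k.+1 -> int) (n : 'I_k.+1 -> nat)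
    (n_gt0 : forall s, (0 < n s)%N)
    (w_a0 : covering_function a n (a ord0) = covering_multiplicity a n)
    (m : 'I_k -> int)
    (m_coprime : forall s : 'I_k, gcdz (m s) (n (lift ord0 s))%:Z = 1)
    (J : {set 'I_k})
    (J_sub : forall s, s \in J ->
       residue_class (a (lift ord0 s)) (n (lift ord0 s)) (a ord0))
    (F : fieldType)
    (F_char : forall p : nat, p \in [pchar F] ->
       ~~ (p %| \big[lcmn/1%N]_(s < k) n (lift ord0 s))%N)
    (P : {mpoly F[k]}) (P_neq0 : P != 0)
    (degP : (total_degree P <= #|J|)%N)
    (P_coef : (P * (\sum_(s < k) 'X_s) ^+ (#|J| - total_degree P))
                @_(squarefree_monomial J) != 0)
    (b c : 'I_k -> F)
    (bc : forall s : 'I_k, b s = c s ->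
       residue_class (a (lift ord0 s)) (n (lift ord0 s)) (a ord0) /\
       s \notin J) :
  exists alpha : R, 0 <= alpha < 1 /\
    forall r : nat, (r < n ord0)%N ->
      (0 < #|J| - total_degree P + 1 <=
       #|` fset_set (restricted_sums P (fun s => [set b s; c s]) b m
             (fun s => n (lift ord0 s)) ((alpha + r%:R) / (n ord0)%:R))|)%N.
Proof.
pose a0 := a ord0; pose n0 := n ord0.
pose as_ (s : 'I_k) := a (lift ord0 s); pose ns (s : 'I_k) := n (lift ord0 s).
pose N := \big[lcmn/1%N]_(s < k) ns s.
have N_gt0 : (0 < N)%N by apply: biglcmn_gt0 => s; apply: n_gt0.
have ns_dvd s : (ns s %| N)%N by rewrite /N (bigD1 s) //= dvdn_lcml.
have N_F : N%:R != 0 :> F := natr_neq0_of_pchar N_gt0 F_char.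
clearbody N.
have [L [f [z prim_z]]] := primitive_root_in_extension N_F.
have N_neq0 : N%:R != 0 :> L by rewrite -(rmorph_nat f) fmorph_eq0.
have m_ns s : coprimez (m s) (ns s) by apply/eqP; exact: m_coprime.
pose cov (x : int) := [set s : 'I_k | (ns s %| (x - as_ s)%R)%Z]%SET.
have J_cov : J \subset cov a0.
  by apply/fintype.subsetP => s /J_sub; rewrite inE -residue_classP inE.
(* The indices of classes through a0 outside J are frozen at x_s = b_s. *)
pose V : {set 'I_k} := ~: (cov a0 :\: J).
have coveredE x : covered as_ ns V x = cov x :&: V.
  by apply/setP => s; rewrite !inE andbC.
have covered_a0 : covered as_ ns V a0 = J.
  rewrite coveredE; apply/setP => s; rewrite !inE.
  have := fintype.subsetP J_cov s; rewrite inE.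
  by case: (s \in J) => [->|_]; case: (_ %| _)%Z.
(* Minimality of the covering function at a0, with class 0 counted separately. *)
have covering_le x :
    ((n0 %| (a0 - a0)%R)%Z + #|cov a0| <= (n0 %| (x - a0)%R)%Z + #|cov x|)%N.
  by have := covering_multiplicity_min a n x; rewrite -w_a0 !covering_functionE.
rewrite subrr dvdz0 in covering_le.
have card_covered x : (#|cov x| + #|J| <= #|covered as_ ns V x| + #|cov a0|)%N.
  rewrite coveredE -(cardsID V (cov x)) -addnA leq_add2l.
  rewrite -(cardsID J (cov a0)) (finset.setIidPr J_cov) addnC leq_add2l.
  by apply: subset_leq_card; apply/fintype.subsetP => s; rewrite !inE => /andP[/negPn].
have covered_ge x : (#|J| <= #|covered as_ ns V x|)%N.
  have := card_covered x; have := covering_le x; case: (_ %| _)%Z => /=; lia.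
have covered_gt x : ~~ (n0 %| x - a0)%Z -> (#|J| < #|covered as_ ns V x|)%N.
  by have := card_covered x; have := covering_le x; case: (_ %| _)%Z => //=; lia.
have bc_V s : s \in V -> b s <> c s.
  move=> sV /bc[a0s sJ]; move: sV.
  by rewrite !inE sJ -residue_classP (mem_set a0s).
set d := (#|J| - total_degree P)%N.
have dE : (total_degree P + d)%N = #|J| by rewrite subnKC.
set sigma : {mpoly F[k]} := \sum_(s < k) 'X_s in P_coef *.
pose Q0 := P * sigma ^+ d.
have n0_gt0 : (0 < n0)%N by apply: n_gt0.
have [||||n0_dvd [t [lt_t coef_t]]] :=
    @exists_freq_coef_coset _ _ f _ _ prim_z N_neq0 _ as_ ns m ns_dvd m_ns b c V n0 a0 Q0.
- by rewrite covered_a0.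
- by move=> s; rewrite inE => /andP[sV _]; apply: bc_V.
- by rewrite covered_a0 -dE; apply: msize_mul_sumX_exp.
- by rewrite covered_a0.
have lt_tn0 : (t * n0 < N)%N by rewrite -ltn_divRL.
(* With alpha = t n0 / N, (alpha + r) / n0 equals (t + r N/n0) / N. *)
exists ((t * n0)%:R / N%:R); split.
  have NR_gt0 : 0 < N%:R :> R by rewrite ltr0n.
  by rewrite divr_ge0 ?ler0n //= ltr_pdivrMr // mul1r ltr_nat.
move=> r lt_r; rewrite addn1 /=.
set u := _ / (n ord0)%:R; set S := fset_set _.
pose j := (t + r * (N %/ n0))%N.
have lt_j : (j < N)%N.
  have : (r.+1 * (N %/ n0) <= N)%N.
    by rewrite -[X in (_ <= X)%N](divnK n0_dvd) mulnC leq_mul2l lt_r orbT.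
  by apply: leq_trans; rewrite mulSn ltn_add2r.
have uE : u = j%:R / N%:R.
  have n0R : n0%:R != 0 :> R by rewrite pnatr_eq0 -lt0n.
  have NR : (N %/ n0)%:R != 0 :> R by rewrite pnatr_eq0 -lt0n divn_dvd_gt0.
  have NE : N%:R = (N %/ n0)%:R * n0%:R :> R by rewrite -natrM divnK.
  by rewrite /u /j -/n0 NE natrD !natrM; field; rewrite NR n0R.
(* Suppose |S| <= d; then the exponent [d - size S] below is an honest difference. *)
rewrite ltnNge; apply/negP => le_S.
pose Q := P * (\prod_(z <- S) (sigma - z%:MP) * sigma ^+ (d - size S)).
have QQ0 : freq_coef f N z as_ ns m b c V (Q - Q0) j = 0.
  apply: freq_coef_small_degree => // x.
  apply: leq_trans (covered_ge x); rewrite -dE; exact: msize_mul_prod_sumX_sub.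
(* At each contributing x^T either P vanishes, or the coordinate sum lies in S and kills a
   factor. *)
have Q_eq0 : freq_coef f N z as_ ns m b c V Q j = 0.
  apply: freq_coef_eq0 => T TV T_j; rewrite /Q !mevalM.
  have [->|P_neq] := eqVneq P.@[switch b c T] 0; first by rewrite mul0r.
  rewrite meval_prod_sumX_eq0 ?mul0r ?mulr0 //.
  rewrite in_fset_set; last exact: restricted_sums_finite.
  apply/mem_set; exists (switch b c T) => //; split => //.
    by move=> s; rewrite /switch; case: ifP => _; [right|left].
  (* Since b_s and c_s differ on V, the indices with x_s different from b_s are exactly those of
     T. *)
  have T_switch s : (switch b c T s != b s) = (s \in T).
    by apply: switch_neq => /(fintype.subsetP TV); apply: bc_V.
  under eq_bigl do rewrite T_switch.
  rewrite uE -(frac_part_divz R lt_j T_j) /exponent rmorph_sum mulr_suml.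
  congr frac_part; apply: eq_bigr => s _.
  have nsR : (ns s)%:R != 0 :> R by rewrite pnatr_eq0 -lt0n; apply: n_gt0.
  have NR : (N %/ ns s)%:R != 0 :> R by rewrite pnatr_eq0 -lt0n divn_dvd_gt0.
  have NE : N%:R = (N %/ ns s)%:R * (ns s)%:R :> R by rewrite -natrM divnK.
  by rewrite rmorphM /= -pmulrn NE -/(ns s); field; rewrite NR nsR.
have := coef_t r; rewrite -/j.
by move: QQ0; rewrite freq_coefB Q_eq0 sub0r => /eqP; rewrite oppr_eq0 => ->.
Qed.
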